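(* Let $k\ge 4$ be a constant and let $f$ be any function with $f(k)=\Omega(k^3)$. There is an infinite family of $k$-claw-free graphs $\{G_n\}$, with $G_n$ having $\Theta(n)$ vertices and $\alpha(G_n)\ge k$, such that the Sherali--Adams hierarchy on $\mathrm{QSTAB}(G_n)$ with $\Omega(n/f(k))$ rounds (i.e., $\mathrm{SA}^+_\ell(G_n)$ for some $\ell=\Omega(n/f(k))$) has integrality gap at least $\Omega(f(k)/k^2)$.
   Context: A graph is $k$-claw-free if it contains no induced $K_{1,k}$. For $G$ on vertex set $[m]$, $\mathrm{SA}^+_\ell(G)$ is the linear program in variables $y_A$, $A\subseteq[m]$: maximize $\sum_{i} y_{\{i\}}$ subject to $y_\emptyset=1$ and, for all disjoint $S,T\subseteq[m]$ with $|S\cup T|\le\ell$: (i) for every clique $Q$, $\sum_{T'\subseteq T}(-1)^{|T'|}y_{S\cup T'}-\sum_{i\in Q}\sum_{T'\subseteq T}(-1)^{|T'|}y_{S\cup T'\cup\{i\}}\ge 0$; (ii) $\sum_{T'\subseteq T}(-1)^{|T'|}y_{S\cup T'}\ge 0$; (iii) for every $i$, $\sum_{T'\subseteq T}(-1)^{|T'|}y_{S\cup T'\cup\{i\}}\ge 0$. This is the $\ell$-round Sherali--Adams strengthening of $\mathrm{QSTAB}(G)=\{x\in[0,1]^m:\sum_{i\in Q}x_i\le1\ \forall\text{ cliques }Q\}$. Its integrality gap is its optimum divided by $\alpha(G)$, the maximum independent set size. *)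

(* Defs.v *)
From HB Require Import structures.
From mathcomp Require Export all_boot all_order all_algebra.
From mathcomp Require Export all_classical all_reals all_analysis.
Set Implicit Arguments.
Unset Strict Implicit.
Unset Printing Implicit Defensive.
Export Order.TTheory GRing.Theory Num.Theory.
Export numFieldNormedType.Exports.
Local Open Scope ring_scope.

Record sgraph (m : nat) := SGraph {
  adj :> rel 'I_m;
  adj_sym : symmetric adj;
  adj_irr : irreflexive adj }.

Section Graphs.
Variable m : nat.
Implicit Types (G : sgraph m) (Q A : {set 'I_m}).

Definition clique G Q : bool :=
  [forall i in Q, forall j in Q, (i != j) ==> G i j].

Definition independent G A : bool :=
  [forall i in A, forall j in A, ~~ G i j].

Definition alpha G : nat := (\max_(A : {set 'I_m} | independent G A) #|A|)%N.

Definition induced_in (p : nat) (H : sgraph p) G : Prop :=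
  exists2 h : 'I_p -> 'I_m, injective h & forall i j, G (h i) (h j) = H i j.

End Graphs.

(* K_{1,k}, with centre ord0 *)
Definition star_adj (k : nat) : rel 'I_k.+1 :=
  fun i j => (i == ord0) (+) (j == ord0).

Lemma star_adj_sym k : symmetric (@star_adj k).
Proof. by move=> i j; rewrite /star_adj addbC. Qed.

Lemma star_adj_irr k : irreflexive (@star_adj k).
Proof. by move=> i; rewrite /star_adj addbb. Qed.

Definition star (k : nat) : sgraph k.+1 :=
  SGraph (@star_adj_sym k) (@star_adj_irr k).

Definition claw_free (k m : nat) (G : sgraph m) : Prop :=
  ~ induced_in (star k) G.

Section SheraliAdams.
Variables (R : realType) (m : nat).
Implicit Types (G : sgraph m) (y : {set 'I_m} -> R) (S T Q : {set 'I_m}).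

(* The linearization of \prod_(i in S) x_i * \prod_(j in T) (1 - x_j). *)
Definition sa_lin y S T : R :=
  \sum_(T' : {set 'I_m} | T' \subset T) (-1) ^+ #|T'| * y (S :|: T').

(* S :|: T' :|: [set i] is written (i |: S) :|: T'; i may belong to T. *)
Definition sa_feasible (l : nat) G y : Prop :=
  y finset.set0 = 1 /\
  forall S T, [disjoint S & T] -> (#|S :|: T| <= l)%N ->
    [/\ forall Q, clique G Q ->
          0 <= sa_lin y S T - \sum_(i in Q) sa_lin y (i |: S) T,
        0 <= sa_lin y S T
      & forall i : 'I_m, 0 <= sa_lin y (i |: S) T].

Definition sa_objective y : R := \sum_(i < m) y [set i]%SET.

(* The program is feasible (y_A = [A is empty]) and S = T = set0, Q = {i} force
   y_{i} <= 1, so this supremum is over a nonempty bounded set of reals. *)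
Definition sa_opt (l : nat) G : R :=
  sup [set sa_objective y | y in [set y | sa_feasible l G y]]%classic.

Definition sa_gap (l : nat) G : R := sa_opt l G / (alpha G)%:R.

End SheraliAdams.

(* Main.v *)
Require Import Defs.
From mathcomp Require Import fintype finset zify lra ring.

(* If independent sets of size at least 2 are ignored, i.e. y is 1 on the empty
   set, p on singletons and 0 elsewhere, every Sherali-Adams constraint of level
   l follows from p * (l + |Q|) <= 1.  Hence a graph whose cliques are a small
   fraction of its vertices has a large gap after linearly many rounds.  The
   complement of a triangle-free graph on V with independence ratio 2 / M has
   clique ratio 2 / M and no three independent vertices; taking k disjoint
   copies and replacing each vertex by a clique of size t gives a k-claw-free
   graph with k |V| t vertices and independence number between k and 2 k.
   With p = f k / (2 n) the value is at least f k / 2, so the gap is at least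
   f k / (4 k). *)

Set Implicit Arguments.
Unset Strict Implicit.
Local Open Scope ring_scope.

(** * Triangle-free graphs of small independence ratio, by a weighted Zykov construction *)

Section ZykovStep.
Local Open Scope nat_scope.

Lemma card_le_fst (U W : finType) (A : {set U * W}) :
  #|A| <= #|[set x.1 | x in A]| * #|W|.
Proof.
rewrite -(cardsT W) -cardsX subset_leq_card //.
by apply/subsetP => x Ax; rewrite !inE andbT imset_f.
Qed.

(* Integer form of [\prod (1 - x_i) <= 1 / (1 + \sum x_i)]. *)
Lemma prod_sub_mul_add_sum (I : Type) (r : seq I) (N : nat) (a : I -> nat) :
  (forall i, a i <= N) ->
  (\prod_(i <- r) (N - a i)) * (N + \sum_(i <- r) a i) <= N ^ (size r).+1.
Proof.
move=> aN; elim: r => [|i r IH] /=; first by rewrite !big_nil; lia.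
rewrite !big_cons (expnS N (size r).+1).
apply: leq_trans (leq_mul (leqnn N) IH); have := aN i.
set P := \prod_(_ <- _) _; set D := \sum_(_ <- _) _; move=> ai.
rewrite (_ : _ * _ = P * ((N - a i) * (N + (a i + D)))); last by ring.
rewrite [leqRHS]mulnCA leq_mul2l; apply/orP; right; nia.
Qed.

Variables (V : finType) (e : rel V) (s p q : nat).

(* s copies of V together with one vertex for each transversal phi, adjacent to
   phi i in the i-th copy; p and q are multiplicities (sizes of the independent
   sets replacing the vertices of the two kinds). *)
Definition zykov_vertex : finType :=
  (('I_s * V) * 'I_p + {ffun 'I_s -> V} * 'I_q)%type.

Definition zykov : rel zykov_vertex := fun x y =>
  match x, y with
  | inl (i, v, _), inl (j, w, _) => (i == j) && e v w
  | inl (i, v, _), inr (phi, _) => phi i == v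
  | inr (phi, _), inl (i, v, _) => phi i == v
  | inr _, inr _ => false
  end.

Lemma zykov_sym : symmetric e -> symmetric zykov.
Proof.
by move=> esym [[[i v] c]|[phi c]] [[[j w] b]|[psi b]] //=; rewrite eq_sym esym.
Qed.

Lemma zykov_irr : irreflexive e -> irreflexive zykov.
Proof. by move=> eirr [[[i v] c]|[phi c]] //=; rewrite eirr andbF. Qed.

(** A transversal sees a single vertex of each copy and no other transversal, so no triangle passes
    through it. *)
Lemma zykov_triangle_free :
  symmetric e -> irreflexive e ->
  (forall x y z, e x y -> e y z -> ~~ e x z) ->
  forall x y z, zykov x y -> zykov y z -> ~~ zykov x z.
Proof.
move=> esym eirr etf.
move=> [[[i v] c]|[phi c]] [[[j w] b]|[psi b]] [[[h u] a]|[chi a]] //=.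
- by move=> /andP[/eqP-> vw] /andP[/eqP-> wu]; rewrite eqxx (etf _ _ _ vw).
- move=> /andP[/eqP-> vw] /eqP pw; apply/eqP => pv.
  by rewrite -pv -pw eirr in vw.
- move=> /eqP<- /eqP<-; apply/negP => /andP[/eqP->].
  by rewrite eirr.
- move=> /eqP<- /andP[/eqP<- wu]; apply/eqP => pu.
  by rewrite -pu eirr in wu.
Qed.

(** [D] adds up the traces of [A] on the copies, each independent for [e], and [P] counts the
    transversals occurring in [A]. These must avoid every trace, so there are at most the product of
    the [#|V| - #|F i|] of them, and the product inequality applies. *)
Lemma zykov_independent (M : nat) (A : {set zykov_vertex}) :
  (forall B : {set V}, {in B &, forall x y, ~~ e x y} -> M * #|B| <= 2 * #|V|) ->
  {in A &, forall x y, ~~ zykov x y} ->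
  exists D P : nat, [/\ #|A| <= p * D + q * P, M * D <= 2 * (#|V| * s)
    & P * (#|V| + D) <= #|V| ^ s.+1].
Proof.
move=> eind Aind.
pose A1 := [set x : ('I_s * V) * 'I_p | inl x \in A].
pose A2 := [set x : {ffun 'I_s -> V} * 'I_q | inr x \in A].
pose F i := [set v | [exists c, inl (i, v, c) \in A]].
pose B := [set x.1 | x in A2].
exists (\sum_i #|F i|), #|B|; split.
- have -> : #|A| = #|A1| + #|A2|.
    rewrite -!sum1_card big_mkcond big_sumType /=; congr addn;
      by rewrite [RHS]big_mkcond; apply: eq_bigr => x _; rewrite inE.
  apply: leq_add; rewrite mulnC; last first.
    by have := card_le_fst A2; rewrite card_ord.
  apply: leq_trans (card_le_fst A1) _; rewrite card_ord leq_mul2r.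
  apply/orP; right.
  have -> : \sum_i #|F i| = #|[set x : 'I_s * V | x.2 \in F x.1]|.
    rewrite (eq_bigr (fun i => \sum_v (v \in F i : nat))) => [|i _].
      rewrite pair_bigA -sum1_card [RHS]big_mkcond; apply: eq_bigr => x _.
      by rewrite [in RHS]inE; case: (_ \in _).
    by rewrite -sum1_card big_mkcond; apply: eq_bigr => v _; case: (_ \in _).
  apply: subset_leq_card; apply/subsetP => x /imsetP[[[i v] c]].
  by move=> Ax ->; rewrite !inE in Ax *; apply/existsP; exists c.
- rewrite big_distrr /= (leq_trans (n := \sum_(i < s) 2 * #|V|)) //.
    apply: leq_sum => i _; apply: eind => v w; rewrite !inE.
    move=> /existsP[c vA] /existsP[b wA].
    by have := Aind _ _ vA wA; rewrite /= eqxx.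
  by rewrite sum_nat_const card_ord mulnC -mulnA.
- have sub : #|B| <= \prod_(i < s) (#|V| - #|F i|).
    apply: (@leq_trans #|family (fun i => [pred v | v \notin F i])|).
      apply: subset_leq_card; apply/subsetP => phi /imsetP[[psi c]].
      rewrite inE => phiA -> /=; apply/familyP => i; rewrite !inE.
      apply/negP => /existsP[b iA].
      by have := Aind _ _ phiA iA; rewrite /= eqxx.
    rewrite card_family foldrE big_map big_enum /=.
    apply/eq_leq; apply: eq_bigr => i _; rewrite -[LHS]cardsE cardsCs.
    by congr (_ - _); apply: eq_card => v; rewrite in_setC in_set negbK.
  apply: leq_trans (leq_mul sub (leqnn _)) _.
  have := @prod_sub_mul_add_sum _ (index_enum 'I_s) #|V| (fun i => #|F i|).
  rewrite (_ : size (index_enum _) = s); last first.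
    by rewrite /index_enum -enumT size_enum_ord.
  by apply => i; exact: max_card.
Qed.

End ZykovStep.

(* One step with M ^ 2 copies, the transversals weighing 2 M + 1 times one copy,
   raises the inverse M / 2 of the independence ratio by at least 1 / 2. *)
Lemma triangle_free_small_independence (M : nat) :
  exists (V : finType) (e : rel V),
  [/\ symmetric e, irreflexive e, (0 < #|V|)%N,
      forall x y z, e x y -> e y z -> ~~ e x z
    & forall A : {set V}, {in A &, forall x y, ~~ e x y} ->
        (M * #|A| <= 2 * #|V|)%N].
Proof.
elim: M => [|M IH].
  exists unit, (fun _ _ => false); split => //; first by rewrite card_unit.
case: (posnP M) => [->|M0].
  exists unit, (fun _ _ => false); split => //; first by rewrite card_unit.
  by move=> A _; rewrite mul1n (leq_trans (max_card _)) // card_unit.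
have [V [e [esym eirr V0 etf eind]]] := IH.
set N := #|V| in V0 eind *; pose s := (M * M)%N.
exists (zykov_vertex V s (N ^ s) (N * (2 * M + 1))), (@zykov V e s _ _).
have cardZ : #|zykov_vertex V s (N ^ s) (N * (2 * M + 1))| =
    (N ^ s.+1 * (s + 2 * M + 1))%N.
  rewrite card_sum !card_prod card_ffun !card_ord expnS -/N.
  by move: (N ^ s)%N => X; ring.
split.
- exact: zykov_sym.
- exact: zykov_irr.
- by rewrite cardZ muln_gt0 expn_gt0 V0 /= addn1.
- exact: zykov_triangle_free.
- move=> A /(zykov_independent eind)[D [P [leA leD leP]]].
  rewrite cardZ; move: #|A| leA leD leP => {A} a; rewrite expnS -/N.
  have : (0 < N ^ s)%N by rewrite expn_gt0 V0.
  move: (N ^ s)%N => X X0 leA leD leP.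
  have {}leD : (D <= 2 * (N * M))%N.
    by rewrite -(leq_pmul2l M0) (leq_trans leD) // /s; lia.
  (* Multiply by [N + D]: the first term is handled by [N + D <= N * (2 * M + 1)], the second by
     [leP], and the two bounds add up exactly. *)
  have bound : (X * D + N * (2 * M + 1) * P <= N * X * (2 * M + 1))%N.
    rewrite -(@leq_pmul2r (N + D)) ?addn_gt0 ?V0 //.
    have h1 := leq_mul (leqnn (N * (2 * M + 1))%N) leP.
    have h2 : (X * D * (N + D) <= X * D * (N * (2 * M + 1)))%N.
      by rewrite leq_mul2l; apply/orP; right; lia.
    rewrite mulnDl -(mulnA (N * _)%N P).
    apply: leq_trans (leq_add h2 h1) _; apply/eq_leq; ring.
  (* What remains is [(M + 1) * (2 * M + 1) <= 2 * (M ^ 2 + 2 * M + 1)]. *)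
  have := leq_mul (leqnn M.+1) (leq_trans leA bound).
  move/leq_trans; apply; rewrite /s.
  have : (0 < N * X)%N by rewrite muln_gt0 V0.
  move: (N * X)%N => Y Y0.
  rewrite mulnCA (mulnCA 2) leq_mul2l; apply/orP; right; nia.
Qed.

(** * The Sherali-Adams solution supported on sets of size at most one *)

Lemma sa_lin_set0 (R : realType) (m : nat) (y : {set 'I_m} -> R) (S : {set 'I_m}) :
  sa_lin y S set0 = y S.
Proof.
rewrite /sa_lin (big_pred1 set0) => [|T']; last by rewrite subset0.
by rewrite cards0 expr0 mul1r setU0.
Qed.

Section SingletonSolution.
Variables (R : realType) (m : nat) (p : R).
Implicit Types (S T Q : {set 'I_m}).

(* The linearization of the signed measure giving mass p to every singleton and
   the remaining mass 1 - p m, possibly negative, to the empty set. *)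
Definition singleton_lin S T : R :=
  (1 - p *+ m) *+ (S == set0) +
  p *+ #|[set j | (S \subset [set j]%SET) && (j \notin T)]%SET|.

Definition singleton_sol S : R := singleton_lin S set0.

(** Expand the factor [1 - x_t]: the subsets avoiding [t] give the first term, those containing [t]
    the second. *)
Lemma sa_lin_setU1 (y : {set 'I_m} -> R) S T (t : 'I_m) : t \notin T ->
  sa_lin y S (t |: T)%SET = sa_lin y S T - sa_lin y (t |: S)%SET T.
Proof.
move=> tT; rewrite /sa_lin (bigID (fun T' : {set 'I_m} => t \in T')) /= addrC.
congr (_ + _).
  apply: eq_bigl => T'; apply/andP/idP => [[/subsetP sub tT']|sub].
    apply/subsetP => x xT'; have := sub _ xT'; rewrite !inE.
    by case: eqP => // xt; rewrite -xt xT' in tT'.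
  split; first exact: subset_trans sub (subsetUr _ _).
  by apply: contra tT; exact: (subsetP sub).
rewrite -sumrN.
rewrite (reindex_onto (fun T' => t |: T')%SET (fun T' => T' :\ t)%SET) /=; last first.
  by move=> T' /andP[_ tT']; exact: setD1K.
apply: eq_big => [T'|T' /andP[/andP[sub _] /eqP T'E]].
  rewrite setU11 andbT; apply/andP/idP => [[sub /eqP <-]|sub].
    rewrite -(setU1K tT); exact: setSD.
  split; first exact: setUS.
  by apply/eqP/setU1K/(contra _ tT); exact: (subsetP sub).
have tT' : t \notin T' by rewrite -T'E !inE eqxx.
rewrite cardsU1 tT' exprS mulN1r mulNr; congr (- (_ * y _)).
by rewrite setUCA setUA.
Qed.

(** By additivity of the measure, [singleton_lin] obeys the recursion of [sa_lin_setU1]; induct on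
    [#|T|]. *)
Lemma sa_lin_singleton S T : sa_lin singleton_sol S T = singleton_lin S T.
Proof.
have [n] := ubnP #|T|; elim: n T S => // n IH T S ltn.
have [->|[t tT]] := set_0Vmem T; first by rewrite sa_lin_set0.
have tT' : t \notin T :\ t by rewrite !inE eqxx.
rewrite -(setD1K tT) in ltn *; rewrite cardsU1 tT' in ltn.
rewrite sa_lin_setU1 // !IH //; move: {T tT ltn}(T :\ t) tT' => T tT.
rewrite /singleton_lin; have -> : (t |: S == set0) = false.
  by apply/eqP => /setP/(_ t); rewrite !inE eqxx.
rewrite mulr0n add0r -addrA -mulrnBr; last first.
  apply: subset_leq_card; apply/subsetP => j; rewrite !inE subUset.
  by case/andP => /andP[_ ->].
congr (_ + _ *+ _); rewrite -cardsDS; last first.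
  apply/subsetP => j; rewrite !inE subUset.
  by case/andP => /andP[_ ->].
apply: eq_card => j; rewrite !inE subUset sub1set inE negb_or (eq_sym t j).
by case: (S \subset _) => //=; case: (j =P t) => [->|]; rewrite ?tT //= andbF.
Qed.

Lemma singleton_linU1 S T (i : 'I_m) :
  singleton_lin (i |: S) T = p *+ ((S \subset [set i]) && (i \notin T)).
Proof.
rewrite /singleton_lin; have -> : (i |: S == set0) = false.
  by apply/eqP => /setP/(_ i); rewrite !inE eqxx.
rewrite mulr0n add0r; congr (_ *+ _).
transitivity #|[set j in pred1 i | (S \subset [set i]) && (i \notin T)]|.
  apply: eq_card => j; rewrite !inE subUset sub1set inE (eq_sym i).
  by case: (j =P i) => // ->.
by case: (_ && _) => /=; [rewrite -(card1 i)|rewrite -[RHS](card0 'I_m)];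
  apply: eq_card => j; rewrite !inE ?andbT ?andbF.
Qed.

(** On sets with at most one element, [1 - \sum_(i in Q) x_i] equals [\prod_(i in Q) (1 - x_i)].
    Clique constraints thus reduce to nonnegativity with [Q] merged into [T]. *)
Lemma singleton_lin_sub_sum S T Q :
  singleton_lin S T - \sum_(i in Q) singleton_lin (i |: S) T =
  singleton_lin S (T :|: Q).
Proof.
rewrite (eq_bigr _ (fun i _ => singleton_linU1 S T i)) sumrMnr.
pose P (U : {set _}) := [set j | (S \subset [set j]) && (j \notin U)].
have -> : (\sum_(i in Q) ((S \subset [set i]) && (i \notin T)) = #|P T :&: Q|)%N.
  rewrite -sum1_card big_mkcond [RHS]big_mkcond; apply: eq_bigr => i _.
  by rewrite !inE; case: (i \in Q); rewrite ?andbT ?andbF //; case: ifP.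
rewrite -addrA -mulrnBr ?subset_leq_card ?subsetIl //.
rewrite -cardsD; congr (_ + _ *+ _); apply: eq_card => j.
by rewrite !inE negb_or; case: (j \in Q); rewrite ?andbF ?andbT.
Qed.

(** For empty [S] the value is [1 - p * #|T|]: singletons outside [T] offset the possibly negative
    mass at the empty set. *)
Lemma singleton_lin_ge0 S T : 0 <= p -> p *+ #|T| <= 1 -> 0 <= singleton_lin S T.
Proof.
move=> p0 pT; rewrite /singleton_lin; have [->|_] := eqVneq S set0; last first.
  by rewrite add0r mulrn_wge0.
rewrite mulr1n (_ : [set j | _] = ~: T); last first.
  by apply/setP => j; rewrite !inE sub0set.
have -> : p *+ m = p *+ #|T| + p *+ #|~: T|.
  by rewrite -mulrnDr cardsC card_ord.
lra.
Qed.

Lemma singleton_sol_feasible (l : nat) (G : sgraph m) : 0 <= p ->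
  (forall T Q, (#|T| <= l)%N -> clique G Q -> p *+ (#|T| + #|Q|) <= 1) ->
  sa_feasible l G singleton_sol.
Proof.
move=> p0 small.
have cl0 : clique G set0 by apply/forallP => i; rewrite inE.
split.
  rewrite /singleton_sol /singleton_lin eqxx mulr1n.
  rewrite (_ : [set j | _] = setT); last first.
    by apply/setP => j; rewrite !inE sub0set.
  by rewrite cardsT card_ord subrK.
move=> S T _ STl.
have Tl : (#|T| <= l)%N by rewrite (leq_trans _ STl) // subset_leq_card ?subsetUr.
have pT : p *+ #|T| <= 1 by have := small T set0 Tl cl0; rewrite cards0 addn0.
split => [Q Qcl||i]; rewrite ?sa_lin_singleton ?singleton_lin_ge0 //.
rewrite (eq_bigr _ (fun i _ => sa_lin_singleton (i |: S) T)).
rewrite singleton_lin_sub_sum singleton_lin_ge0 // (le_trans _ (small T Q Tl Qcl)) //.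
by rewrite ler_wpMn2l // cardsU leq_subr.
Qed.

Lemma singleton_sol_objective : sa_objective singleton_sol = p *+ m.
Proof.
rewrite /sa_objective (eq_bigr (fun=> p)) ?sumr_const ?card_ord // => i _.
by rewrite /singleton_sol -[[set i]]setU0 singleton_linU1 sub0set inE.
Qed.

End SingletonSolution.

Lemma sa_objective_le_opt (R : realType) (m l : nat) (G : sgraph m)
    (y : {set 'I_m} -> R) :
  sa_feasible l G y -> sa_objective y <= sa_opt R l G.
Proof.
move=> yfeas; apply: ub_le_sup; last by exists y.
(* [sup] dominates its members only when the set is bounded; the cliques [{i}] bound each term by
   1. *)
exists m%:R => _ [z [z0 zfeas] <-]; rewrite /sa_objective.
rewrite -[m in leRHS]card_ord -sumr_const ler_sum // => i _.
have cl : clique G [set i].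
  apply/forallP => j; apply/implyP; rewrite inE => /eqP->.
  by apply/forallP => j'; apply/implyP; rewrite inE => /eqP->; rewrite eqxx.
have [||/(_ _ cl)] := zfeas (@set0 _) (@set0 _).
- by rewrite disjoints_subset sub0set.
- by rewrite setU0 (leq_trans (eq_leq (cards0 _))).
by rewrite big_set1 !sa_lin_set0 z0 setU0 subr_ge0.
Qed.

(** * Blow-up of copies of the complement: claws, independent sets and cliques *)

Section BlowUp.
Local Open Scope nat_scope.
Variables (V : finType) (e : rel V) (k t : nat).
Hypotheses (esym : symmetric e) (eirr : irreflexive e).
Hypothesis etf : forall x y z, e x y -> e y z -> ~~ e x z.

Definition blowup_vertex : finType := (('I_k * V) * 'I_t)%type.

(* Inside a copy, this is the complement of e with each vertex replaced by a
   clique of size t (e being irreflexive). *)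
Definition blowup_adj : rel 'I_#|blowup_vertex| := fun i j =>
  let x : blowup_vertex := enum_val i in let y : blowup_vertex := enum_val j in
  [&& x.1.1 == y.1.1, i != j & ~~ e x.1.2 y.1.2].

Lemma blowup_sym : symmetric blowup_adj.
Proof. by move=> i j; rewrite /blowup_adj eq_sym (eq_sym i) esym. Qed.

Lemma blowup_irr : irreflexive blowup_adj.
Proof. by move=> i; rewrite /blowup_adj !eqxx. Qed.

Definition blowup : sgraph #|blowup_vertex| := SGraph blowup_sym blowup_irr.

Let copy (i : 'I_#|blowup_vertex|) : 'I_k := (enum_val i).1.1.
Let base (i : 'I_#|blowup_vertex|) : V := (enum_val i).1.2.

Let nonadj (i j : 'I_#|blowup_vertex|) :
  copy i = copy j -> i != j -> ~~ blowup i j -> e (base i) (base j).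
Proof. by rewrite /copy /base /= /blowup_adj => -> ->; rewrite eqxx negbK. Qed.

(** All leaves lie in the copy of the centre. Being pairwise nonadjacent, three of them would
    project to a triangle of [e]. *)
Lemma blowup_claw_free : 4 <= k -> claw_free k blowup.
Proof.
move=> k4 [h hinj hstar].
have same i : i != ord0 -> copy (h i) = copy (h ord0).
  move=> i0; have : blowup (h i) (h ord0).
    by rewrite hstar /= /star_adj eqxx (negPf i0).
  by case/and3P => /eqP.
have edge i j : i != ord0 -> j != ord0 -> i != j -> e (base (h i)) (base (h j)).
  move=> i0 j0 ij; apply: nonadj; rewrite ?same // ?(inj_eq hinj) //.
  by rewrite hstar /= /star_adj (negPf i0) (negPf j0).
pose a : 'I_k.+1 := inord 1; pose b : 'I_k.+1 := inord 2.
pose c : 'I_k.+1 := inord 3.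
have [va vb vc] : [/\ a = 1 :> nat, b = 2 :> nat & c = 3 :> nat].
  by split; rewrite inordK //; lia.
suff : ~~ e (base (h a)) (base (h c)).
  by rewrite edge // -val_eqE /= ?va ?vc.
by apply: (etf (y := base (h b))); rewrite edge // -val_eqE /= ?va ?vb ?vc.
Qed.

Lemma blowup_alpha_ge : 0 < #|V| -> 0 < t -> k <= alpha blowup.
Proof.
move=> /card_gt0P[v _]; rewrite -{1}(card_ord t) => /card_gt0P[c _].
pose f (i : 'I_k) : 'I_#|blowup_vertex| := enum_rank ((i, v, c) : blowup_vertex).
have finj : injective f by move=> i j /enum_rank_inj[].
have ind : independent blowup [set f i | i in 'I_k].
  apply/forallP => x; apply/implyP => /imsetP[i _ ->].
  apply/forallP => y; apply/implyP => /imsetP[j _ ->].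
  apply/negP => /and3P[]; rewrite !enum_rankK /= => /eqP->.
  by rewrite eqxx.
apply: (bigop.bigmax_sup [set f i | i in 'I_k]) => //.
by rewrite card_imset // card_ord.
Qed.

(** Three independent vertices in one copy would project to a triangle of [e], so each copy
    contributes at most two. *)
Lemma blowup_alpha_le : alpha blowup <= 2 * k.
Proof.
apply/bigop.bigmax_leqP => A Aind.
rewrite -sum1_card (partition_big copy predT) //= mulnC.
apply: (@leq_trans (\sum_(i < k) 2)); last by rewrite sum_nat_const card_ord.
apply: leq_sum => i _.
rewrite sum1_card leqNgt; apply/negP => /card_gt2P[x [y [z [[xA yA zA] [xy yz zx]]]]].
have edge u w : u \in [pred x in A | copy x == i] ->
    w \in [pred x in A | copy x == i] -> u != w -> e (base u) (base w).
  rewrite !inE => /andP[uA /eqP ui] /andP[wA /eqP wi] uw.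
  apply: nonadj; rewrite ?ui ?wi //.
  by move/forallP/(_ u)/implyP/(_ uA)/forallP/(_ w)/implyP/(_ wA): Aind.
suff : ~~ e (base x) (base z) by rewrite edge // eq_sym.
by apply: (etf (y := base y)); rewrite edge.
Qed.

(** A clique stays in one copy, its projection to [V] is independent for [e], and each fibre has at
    most [t] points. *)
Lemma blowup_clique (M : nat) (Q : {set 'I_#|blowup_vertex|}) :
  (forall B : {set V}, {in B &, forall x y, ~~ e x y} -> M * #|B| <= 2 * #|V|) ->
  clique blowup Q -> M * #|Q| <= 2 * #|V| * t.
Proof.
move=> eind Qcl.
have adjQ i j : i \in Q -> j \in Q -> i != j -> blowup i j.
  move=> iQ jQ; apply/implyP.
  by move/forallP/(_ i)/implyP/(_ iQ)/forallP/(_ j)/implyP/(_ jQ): Qcl.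
pose g i : V * 'I_t := (base i, (enum_val i).2).
have ginj : {in Q &, injective g}.
  move=> i j iQ jQ; have [//|ij] := eqVneq i j.
  have /and3P[/eqP] := adjQ _ _ iQ jQ ij.
  rewrite /g /base => same _ _ [] ebase efib; apply: enum_val_inj.
  move: same ebase efib.
  by case: (enum_val i) => [[? ?] ?]; case: (enum_val j) => [[? ?] ?] /= -> -> ->.
rewrite -(card_in_imset ginj).
apply: leq_trans (leq_mul (leqnn M) (card_le_fst _)) _; rewrite card_ord.
rewrite mulnA leq_mul2r; apply/orP; right; apply: eind => v w.
move=> /imsetP[_ /imsetP[i iQ ->] ->] /imsetP[_ /imsetP[j jQ ->] ->] /=.
have [->|ij] := eqVneq i j; first by rewrite eirr.
by have /and3P[] := adjQ _ _ iQ jQ ij.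
Qed.

End BlowUp.

(** * Choice of parameters and the gap estimate *)

Local Open Scope classical_set_scope.

Theorem theorem8 (R : realType) :
  exists a b c d : R, [/\ 0 < a, 0 < b, 0 < c & 0 < d] /\
  forall (k : nat) (f : nat -> R), (4 <= k)%N ->
    f \is 'Omega_\oo (fun j : nat => j%:R ^+ 3 : R) ->
  exists (m : nat -> nat) (G : forall n : nat, sgraph (m n)) (l : nat -> nat),
    (forall n : nat, claw_free k (G n) /\ (k <= alpha (G n))%N) /\
    \forall n \near \oo,
      [/\ a * n%:R <= (m n)%:R <= b * n%:R,
          c * (n%:R / f k) <= (l n)%:R
        & d * (f k / k%:R ^+ 2) <= sa_gap R (l n) (G n)].
Proof.
exists 1, 2, (1 / 2), (1 / 4); split; first by split; lra.
move=> k f k4 _.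
(* [f k] may be negative, hence the truncation at 0. [M > 4 * v] will give [v * #|Q| <= n] for every
   clique [Q]. *)
pose v : R := Num.max (f k) 0; pose M := (Num.truncn (4 * v)).+1.
have v0 : 0 <= v by rewrite le_max lexx orbT.
have fv : f k <= v by rewrite le_max lexx.
have vE : 0 < f k -> v = f k by move=> fk0; apply/max_idPl/ltW.
have vM : 4 * v < M%:R by rewrite truncnS_gt.
clearbody v M.
have [V [e [esym eirr V0 etf eind]]] := triangle_free_small_independence M.
(* Rounding up makes the order at least [n], and at most [2 * n] once [n >= k * #|V|]. *)
pose t n := (n %/ (k * #|V|)).+1.
exists (fun n => #|blowup_vertex V k (t n)|),
  (fun n => blowup k (t n) esym), (fun n => Num.truncn (n%:R / v)).
split=> [n|].
  by split; [exact: blowup_claw_free | exact: blowup_alpha_ge].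
(* The summand [M] ensures [n / v >= 2] when [v > 0], so truncating the number of rounds costs at
   most a factor 2. *)
exists (k * #|V| + M)%N => // n /= leKn.
set G := blowup _ _ _; set m := #|blowup_vertex _ _ _|.
have k0 : 0 < k%:R :> R by rewrite ltr0n (leq_trans _ k4).
have kV0 : (0 < k * #|V|)%N by rewrite muln_gt0 V0 (leq_trans _ k4).
have n0 : 0 < n%:R :> R by rewrite ltr0n (leq_trans kV0) // (leq_trans _ leKn) // leq_addr.
have leMn : M%:R <= n%:R :> R by rewrite ler_nat (leq_trans _ leKn) // leq_addl.
have mE : m = (k * #|V| * t n)%N by rewrite /m !card_prod !card_ord.
have nm : (n <= m)%N by rewrite mE mulnC ltnW // ltn_ceil.
have mn : (m <= 2 * n)%N.
  rewrite mE mulnS mul2n -addnn leq_add //; last by rewrite mulnC leq_divM.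
  by rewrite (leq_trans _ leKn) // leq_addr.
have lv : (Num.truncn (n%:R / v))%:R * v <= n%:R.
  have [->|vN0] := eqVneq v 0; first by rewrite mulr0.
  have vgt0 : 0 < v by rewrite lt_def vN0.
  by rewrite -ler_pdivlMr // truncn_le // divr_ge0 // ltW.
split.
- by rewrite mul1r -natrM !ler_nat nm mn.
(* For [f k <= 0] the required number of rounds is at most 0, with [n / 0 = 0]. *)
- have [fk0|fk0] := leP (f k) 0.
    apply: le_trans (ler0n _ _).
    by rewrite mulr_ge0_le0 ?divr_ge0 // mulr_ge0_le0 // invr_le0.
  have {}vE := vE fk0; rewrite -vE in fk0 *.
  have : n%:R / v < (Num.truncn (n%:R / v))%:R + 1 by rewrite natr1 truncnS_gt.
  have : 2 <= n%:R / v by rewrite ler_pdivlMr //; lra.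
  lra.
(* Half of the budget [p * (#|T| + #|Q|) <= 1] goes to [T], half to [Q]. *)
- pose p : R := v / (2 * n%:R).
  have p0 : 0 <= p by rewrite divr_ge0 // mulr_ge0 // ltW.
  have feas : sa_feasible (Num.truncn (n%:R / v)) G (singleton_sol p).
    apply: singleton_sol_feasible => // T Q Tl Qcl.
    have leQ : v * #|Q|%:R <= n%:R.
      have := blowup_clique eirr eind Qcl; rewrite -/m => leQ.
      have {leQ} : (M * #|Q| <= 4 * n)%N.
        apply: leq_trans leQ _; move: mn; rewrite mE; nia.
      rewrite -(ler_nat R) !natrM => leQ.
      have : 4 * v * #|Q|%:R <= M%:R * #|Q|%:R by rewrite ler_wpM2r // ltW.
      lra.
    have leT : v * #|T|%:R <= n%:R.
      by apply: le_trans lv; rewrite mulrC ler_wpM2r // ler_nat.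
    rewrite -[p *+ _]mulr_natr natrD /p mulrAC ler_pdivrMr ?mulr_gt0 //; lra.
  have := sa_objective_le_opt feas; rewrite singleton_sol_objective => opt.
  have alpha_ge : k%:R <= (alpha G)%:R :> R by rewrite ler_nat blowup_alpha_ge.
  have alpha_le : (alpha G)%:R <= 2 * k%:R :> R.
    by rewrite -natrM ler_nat blowup_alpha_le.
  have pm : v / 2 <= p *+ m.
    rewrite -[p *+ _]mulr_natr /p mulrAC ler_pdivlMr ?mulr_gt0 //.
    have : v * n%:R <= v * m%:R by rewrite ler_wpM2l // ler_nat.
    lra.
  have vk : f k / k%:R ^+ 2 <= v / k%:R.
    rewrite ler_pdivrMr ?exprn_gt0 // expr2 mulrA divfK ?gt_eqF //.
    by rewrite (le_trans fv) // ler_peMr // ler1n (leq_trans _ k4).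
  rewrite /sa_gap ler_pdivlMr ?(lt_le_trans k0) //.
  apply: le_trans opt; apply: le_trans pm.
  (* With [alpha G <= 2 * k], the middle term is exactly [v / 2]. *)
  apply: (@le_trans _ _ (1 / 4 * (v / k%:R) * (2 * k%:R))).
    have vk0 : 0 <= v / k%:R by rewrite divr_ge0 // ltW.
    apply: le_trans (_ : 1 / 4 * (v / k%:R) * (alpha G)%:R <= _).
      by rewrite ler_wpM2r // ler_wpM2l //; lra.
    by rewrite ler_wpM2l // mulr_ge0 //; lra.
  by rewrite le_eqVlt; apply/orP; left; apply/eqP; field; rewrite gt_eqF.
Qed.
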